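(* Let $\mathfrak{n}=\mathfrak{n}_1\oplus\mathfrak{n}_2$ be a real vector space with $\dim\mathfrak{n}_1=m\ge 1$, $\dim\mathfrak{n}_2=n\ge 1$, let $\langle\cdot,\cdot\rangle$ be an inner product on $\mathfrak{n}$ with $\mathfrak{n}_1\perp\mathfrak{n}_2$, and let $\mu:\mathfrak{n}_1\times\mathfrak{n}_1\to\mathfrak{n}_2$ be a bilinear skew-symmetric map which is nonsingular. If $\langle\cdot,\cdot\rangle$ is a nilsoliton inner product for the Lie algebra $(\mathfrak{n},\mu)$, then there exist real numbers $a,b<0$ such that for any orthonormal basis $\{Z_1,\dots,Z_n\}$ of $\mathfrak{n}_2$, $$\sum_{i=1}^n J_\mu(Z_i)^2=aI,\qquad \operatorname{tr}\big(J_\mu(Z_i)J_\mu(Z_j)\big)=b\,\delta_{ij}\quad\text{for all } i,j.$$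
   Context: A bilinear skew-symmetric map $\mu:\mathfrak{n}_1\times\mathfrak{n}_1\to\mathfrak{n}_2$ is regarded as a $2$-step nilpotent Lie bracket on $\mathfrak{n}=\mathfrak{n}_1\oplus\mathfrak{n}_2$ (with $\mathfrak{n}_2$ central). Given $\langle\cdot,\cdot\rangle$ with $\mathfrak{n}_1\perp\mathfrak{n}_2$, the map $J_\mu:\mathfrak{n}_2\to\mathfrak{so}(\mathfrak{n}_1)$ is defined by $\langle J_\mu(Z)X,Y\rangle=\langle\mu(X,Y),Z\rangle$ for $X,Y\in\mathfrak{n}_1$, $Z\in\mathfrak{n}_2$. $\mu$ is called nonsingular if $J_\mu(Z)$ is invertible for every nonzero $Z\in\mathfrak{n}_2$ (equivalently, $\mathfrak{n}_1\to\mathfrak{n}_2$, $Y\mapsto\mu(X,Y)$ is onto for every nonzero $X\in\mathfrak{n}_1$); this does not depend on the inner product. An inner product on $\mathfrak{n}$ is called a nilsoliton for $(\mathfrak{n},\mu)$ if the left-invariant Riemannian metric $g$ it determines on the simply connected nilpotent Lie group $N$ with Lie algebra $(\mathfrak{n},\mu)$ is a Ricci soliton, i.e. the Ricci flow solution starting at $g$ evolves only by time-dependent scaling and pull-back by diffeomorphisms. In this setting this is known to be equivalent to: the Ricci operator of $g$ (an endomorphism of $\mathfrak{n}$) equals $cI+D$ for some $c\in\mathbb{R}$ and some derivation $D$ of $(\mathfrak{n},\mu)$. *)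

(* Defs.v *)
From HB Require Import structures.
From mathcomp Require Import all_boot all_order all_algebra.
From mathcomp Require Import ring reals.

Set Implicit Arguments.
Unset Strict Implicit.
Unset Printing Implicit Defensive.

Import Order.TTheory GRing.Theory Num.Theory.
Import passmx.

Local Open Scope ring_scope.

Section LinearAlgebra.
Variables (R : realType) (V : vectType R).

(* Independent of the basis: see lftrace_basis. *)
Definition lftrace (f : 'End(V)) : R :=
  \tr (mxof (vbasis {:V}) (vbasis {:V}) f).

Lemma lftrace_basis (e : (\dim {:V}).-tuple V) (f : 'End(V)) :
  basis_of {:V} e -> \tr (mxof e e f) = lftrace f.
Proof.
move=> eB; have bB := vbasisP {:V}; rewrite /lftrace.
have -> : mxof e e f = mxof e (vbasis {:V}) \1 *m
    (mxof (vbasis {:V}) (vbasis {:V}) f *m mxof (vbasis {:V}) e \1).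
  by rewrite -!mxof_comp // comp_lfun1l comp_lfun1r.
rewrite mxtrace_mulC -mulmxA -mxof_comp // comp_lfun1l mxof1 ?mulmx1 //.
exact: basis_free bB.
Qed.

(* The vector v representing the linear form phi, i.e. g v y = phi y for all y:
   the preimage of phi under the linear map v |-> g v _ from V to its dual. *)
Definition riesz (g : V -> V -> R) (phi : V -> R) : V :=
  ((linfun (fun v : V => linfun (g v : V -> R^o)))^-1)%VF
    (linfun (phi : V -> R^o)).

Lemma lfun_linE (W : vectType R) (f : V -> W) : linear f -> linfun f =1 f.
Proof.
move=> fL.
pose fM := GRing.isSemilinear.Build R V W _ f (GRing.semilinear_linear fL).
pose f' : {linear V -> W} := HB.pack f fM.
exact: (lfunE f').
Qed.

Lemma rieszP (g : V -> V -> R) (phi : V -> R) :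
    bilinear_for *%R *%R g -> (forall v, g v v = 0 -> v = 0) ->
    (forall a u v, phi (a *: u + v) = a * phi u + phi v) ->
  forall y, g (riesz g phi) y = phi y.
Proof.
move=> [gl gr] gpos phiL y.
have gE v : linfun (g v : V -> R^o) =1 g v.
  by apply: (@lfun_linE R^o (g v)) => a u w; apply: gr.
pose F := linfun (fun v : V => linfun (g v : V -> R^o)).
have FE v : F v = linfun (g v : V -> R^o).
  apply: (@lfun_linE _ (fun v : V => linfun (g v : V -> R^o))) => a u w.
  by apply/lfunP => z; rewrite add_lfunE scale_lfunE !gE; apply: gl.
have kF : lker F == 0%VS.
  apply/lker0P => u v; rewrite !FE => /lfunP E; apply/eqP; rewrite -subr_eq0.
  apply/eqP/gpos; have := E (u - v); rewrite !gE => Euv.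
  have /= := gl (u - v) (-1) v u; rewrite scaleN1r [- v + u]addrC => ->.
  by rewrite Euv mulN1r addNr.
have dF : limg F = fullv.
  apply/eqP; rewrite eqEdim subvf limg_dim_eq ?(eqP kF) ?capv0 //=.
  by rewrite !dimvf /= /dim /= muln1.
have : F (riesz g phi) = linfun (phi : V -> R^o).
  by rewrite /riesz limg_lfunVK // dF memvf.
rewrite FE => /lfunP /(_ y); rewrite gE => ->.
by apply: (@lfun_linE R^o phi).
Qed.

End LinearAlgebra.

Section MetricLieAlgebra.
Variables (R : realType) (V : vectType R).
Variables (g : V -> V -> R) (br : V -> V -> V).

(* Curvature of the left-invariant metric on the simply connected Lie group
   with Lie algebra (V, br) that restricts to g at the identity, computed on
   left-invariant vector fields. *)

(* Levi-Civita connection, by the Koszul formula; the derivative terms of the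
   formula vanish since g is constant on left-invariant fields. *)
Definition lc_conn (x y : V) : V :=
  riesz g (fun z => (g (br x y) z - g (br y z) x + g (br z x) y) / 2).

Definition riem_curv (x y z : V) : V :=
  lc_conn x (lc_conn y z) - lc_conn y (lc_conn x z) - lc_conn (br x y) z.

Definition ricci_tensor (y z : V) : R :=
  lftrace (linfun (fun x => riem_curv x y z)).

Definition ricci_op : 'End(V) :=
  linfun (fun y => riesz g (ricci_tensor y)).

Definition is_derivation (D : 'End(V)) : Prop :=
  forall x y, D (br x y) = br (D x) y + br x (D y).

(* Left-invariant Ricci solitons on nilpotent Lie groups, in the algebraic
   form Ric = c I + D (equivalent to being a Ricci soliton in this setting). *)
Definition nilsoliton : Prop :=
  exists (c : R) (D : 'End(V)), is_derivation D /\ ricci_op = c *: \1%VF + D.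

End MetricLieAlgebra.

Section MetricLieAlgebraTheory.
Variables (R : realType) (V : vectType R).
Variables (g : {dot V for idfun}) (br : {bilinear V -> V -> V}).

Lemma dot_bilinear : bilinear_for *%R *%R (g : V -> V -> R).
Proof.
by split=> u a v w; [rewrite linearPl | rewrite linearPr].
Qed.

Lemma dot_eq0 (v : V) : g v v = 0 -> v = 0.
Proof.
by move=> gv0; apply/eqP/negPn/negP => /(neq0_dnorm_gt0 (s := g)); rewrite gv0 ltxx.
Qed.

Lemma dot_ext (u v : V) : (forall z, g u z = g v z) -> u = v.
Proof.
move=> E; apply/eqP; rewrite -subr_eq0; apply/eqP/dot_eq0.
by rewrite linearBl /= E subrr.
Qed.

Let gl a (u v w : V) : g (a *: u + v) w = a * g u w + g v w.
Proof. exact: dot_bilinear.1. Qed.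

Let gr a (u v w : V) : g w (a *: u + v) = a * g w u + g w v.
Proof. exact: dot_bilinear.2. Qed.

Let gB (u v w : V) : g (u - v) w = g u w - g v w.
Proof. exact: linearBl. Qed.

Let bl a (u v w : V) : br (a *: u + v) w = a *: br u w + br v w.
Proof. exact: linearPl. Qed.

Let brr a (u v w : V) : br w (a *: u + v) = a *: br w u + br w v.
Proof. exact: linearPr. Qed.

Lemma lc_connP (x y z : V) :
  g (lc_conn g br x y) z = (g (br x y) z - g (br y z) x + g (br z x) y) / 2.
Proof.
rewrite /lc_conn rieszP //; [exact: dot_bilinear | exact: dot_eq0 |].
by move=> a u v; rewrite bl brr !(gl, gr); ring.
Qed.

Lemma lc_conn_linl (y : V) : linear (lc_conn g br ^~ y).
Proof.
move=> a u v; apply: dot_ext => z.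
by rewrite gl !lc_connP bl brr !(gl, gr); ring.
Qed.

Lemma lc_conn_linr (x : V) : linear (lc_conn g br x).
Proof.
move=> a u v; apply: dot_ext => z.
by rewrite gl !lc_connP bl brr !(gl, gr); ring.
Qed.

Lemma riem_curv_lin1 (y z : V) : linear (fun x => riem_curv g br x y z).
Proof.
move=> a u v; rewrite /riem_curv bl !(lc_conn_linl, lc_conn_linr).
by apply: dot_ext => w; rewrite !(gl, gB); ring.
Qed.

Lemma ricci_tensorE (y z : V) :
  ricci_tensor g br y z = \sum_i coord (vbasis {:V}) i
                             (riem_curv g br (vbasis {:V})`_i y z).
Proof.
rewrite /ricci_tensor /lftrace /mxtrace; apply: eq_bigr => i _.
by rewrite !mxE /= vecof_delta lfun_linE //; apply: riem_curv_lin1.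
Qed.

Lemma ricci_tensor_linr (y : V) (a : R) (u v : V) :
  ricci_tensor g br y (a *: u + v) =
  a * ricci_tensor g br y u + ricci_tensor g br y v.
Proof.
rewrite !ricci_tensorE mulr_sumr -big_split; apply: eq_bigr => i _ /=.
rewrite -linearP; congr (coord _ _ _).
rewrite /riem_curv !lc_conn_linr; apply: dot_ext => w.
by rewrite !(gl, gB); ring.
Qed.

Lemma ricci_tensor_linl (z : V) (a : R) (u v : V) :
  ricci_tensor g br (a *: u + v) z =
  a * ricci_tensor g br u z + ricci_tensor g br v z.
Proof.
rewrite !ricci_tensorE mulr_sumr -big_split; apply: eq_bigr => i _ /=.
rewrite -linearP; congr (coord _ _ _).
rewrite /riem_curv brr !(lc_conn_linl, lc_conn_linr); apply: dot_ext => w.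
by rewrite !(gl, gB); ring.
Qed.

Lemma ricci_opP (y z : V) :
  g (ricci_op g br y) z = ricci_tensor g br y z.
Proof.
have rP u w : g (riesz g (ricci_tensor g br u)) w = ricci_tensor g br u w.
  rewrite rieszP //; [exact: dot_bilinear | exact: dot_eq0 |].
  by move=> *; apply: ricci_tensor_linr.
rewrite /ricci_op lfun_linE // => a u v; apply: dot_ext => w.
by rewrite gl !rP ricci_tensor_linl.
Qed.

End MetricLieAlgebraTheory.

Section TwoStep.
Variables (R : realType) (V1 V2 : vectType R).

Definition bracket (mu : V1 -> V1 -> V2) (x y : V1 * V2) : V1 * V2 :=
  (0, mu x.1 y.1).

Variables (g : V1 * V2 -> V1 * V2 -> R) (mu : V1 -> V1 -> V2).

Definition dot1 (X Y : V1) : R := g (X, 0) (Y, 0).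
Definition dot2 (Z W : V2) : R := g (0, Z) (0, W).

(* Characterized by <J(Z)X, Y> = <mu(X, Y), Z>: see Jmap_spec. *)
Definition Jmap (Z : V2) : 'End(V1) :=
  linfun (fun X => riesz dot1 (fun Y => dot2 (mu X Y) Z)).

Definition nonsingular : Prop := forall Z : V2, Z != 0 -> bijective (Jmap Z).

Definition orthonormal_basis2 (n : nat) (Z : n.-tuple V2) : Prop :=
  basis_of {:V2} Z /\
  forall i j : 'I_n, dot2 (tnth Z i) (tnth Z j) = (i == j)%:R.

End TwoStep.

Section TwoStepTheory.
Variables (R : realType) (V1 V2 : vectType R).
Variables (g : {dot (V1 * V2)%type for idfun}).
Variables (mu : {bilinear V1 -> V1 -> V2}).

Lemma bracket_bilinear : bilinear_for *:%R *:%R (bracket mu).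
Proof.
split=> w a u v; congr pair => /=; rewrite ?scaler0 ?addr0 //.
  exact: linearPl.
exact: linearPr.
Qed.

HB.instance Definition _ :=
  bilinear_isBilinear.Build R (V1 * V2)%type (V1 * V2)%type (V1 * V2)%type
    *:%R *:%R (bracket mu) bracket_bilinear.

Let pair1 a (u v : V1) : (a *: u + v, 0) = a *: (u, 0) + (v, 0) :> V1 * V2.
Proof. by congr pair; rewrite /= scaler0 addr0. Qed.

Let pair2 a (u v : V2) : (0, a *: u + v) = a *: (0, u) + (0, v) :> V1 * V2.
Proof. by congr pair; rewrite /= scaler0 addr0. Qed.

Let gP := dot_bilinear g.

Lemma dot1_bilinear : bilinear_for *%R *%R (dot1 g).
Proof.
by split=> w a u v; rewrite /dot1 pair1; [apply: gP.1 | apply: gP.2].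
Qed.

Lemma dot1_eq0 (X : V1) : dot1 g X X = 0 -> X = 0.
Proof. by move/dot_eq0 => []. Qed.

Lemma Jmap_spec (Z : V2) (X Y : V1) :
  g (Jmap g mu Z X, 0) (Y, 0) = g (0, mu X Y) (0, Z).
Proof.
have rP U W : dot1 g (riesz (dot1 g) (fun Y => dot2 g (mu U Y) Z)) W =
              dot2 g (mu U W) Z.
  rewrite rieszP //; [exact: dot1_bilinear | exact: dot1_eq0 |].
  by move=> a u v; rewrite linearPr /dot2 pair2; apply: gP.1.
rewrite -/(dot1 g _ _) /Jmap lfun_linE ?rP // => a u v.
have dl c p q w : dot1 g (c *: p + q) w = c * dot1 g p w + dot1 g q w.
  exact: dot1_bilinear.1.
have dB p q w : dot1 g (p - q) w = - dot1 g q w + dot1 g p w.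
  by rewrite addrC -scaleN1r dl mulN1r.
apply/eqP; rewrite -subr_eq0; apply/eqP/dot1_eq0.
by rewrite dB dl !rP linearPl /dot2 pair2 gP.1 addNr.
Qed.

End TwoStepTheory.

(* Main.v *)
Require Import Defs.
From HB Require Import structures.
From mathcomp Require Import all_boot all_order all_algebra.
From mathcomp Require Import reals.
From mathcomp Require Import ring lra spectral complex.

Set Implicit Arguments.
Unset Strict Implicit.
Unset Printing Implicit Defensive.

Import Order.TTheory GRing.Theory Num.Theory.
Import passmx.

Local Open Scope ring_scope.

(** A derivation D of a 2-step algebra with Ric = c I + D has diagonal blocks
    D1, D2 which are self-adjoint, because
      Ric|n1 = 1/2 sum_i J(Z_i)^2  and  <Ric Z, W> = -1/4 tr(J(Z) J(W)) on n2.
    The derivation property reads J(D2 Z) = J(Z) D1 + D1 J(Z).  At an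
    eigenvector Z of D2, with J(Z) invertible, the trace of
    J(Z)^-1 J(D2 Z) gives the eigenvalue l = 2 tr D1 / m; hence D2 = l I.
    Then S = D1 - (l/2) I is traceless and anticommutes with every J(Z), so
    tr(S J(Z)^2) = 0; since S equals 1/2 sum_i J(Z_i)^2 up to a scalar matrix,
    tr S^2 = 0 and S = 0. *)

(** * Self-adjoint endomorphisms and orthonormal bases *)

(** Over [R[i]] the matrix becomes hermitian, hence unitarily diagonalizable with real diagonal.
    Each diagonal entry is then an eigenvalue of [A] over [R], so the diagonal matrix is scalar, and
    conjugating it back changes nothing. *)
Lemma symmetric_scalar_mx (R : rcfType) (n : nat) (A : 'M[R]_n) (l : R) :
  A^T = A -> (forall a, eigenvalue A a -> a = l) -> A = l%:M.
Proof.
move=> Asym Al; pose f : {rmorphism R -> R[i]} := real_complex R.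
pose B := map_mx f A.
have fJ x : (f x)^* = f x by exact: conjc_real.
have Bherm : B \is hermsymmx.
  apply/is_hermitianmxP; rewrite expr0 scale1r; apply/matrixP => i j.
  by rewrite !mxE /= fJ -[in LHS]Asym mxE.
have /hermitian_normalmx/orthomx_spectralP BE := Bherm.
pose P := spectralmx B; have Pu : P \in unitmx by exact: spectral_unit.
have PB : P *m B = diag_mx (spectral_diag B) *m P.
  by rewrite {1}BE -!mulmxA mulKVmx.
have dE : diag_mx (spectral_diag B) = (f l)%:M.
  rewrite -diag_const_mx; congr diag_mx; apply/rowP => i; rewrite [RHS]mxE.
  have := hermitian_spectral_diag_real Bherm.
  move=> /mxOverP /(_ 0 i) /complex_realP [k kE].
  rewrite kE; congr (f _); apply: Al.
  (* Being a root of the characteristic polynomial is insensitive to the embedding [f], so it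
     suffices that row [i] of [P] is a left eigenvector of [B]; it is nonzero because [P] is
     invertible. *)
  rewrite eigenvalue_root_char -(fmorph_root f) map_char_poly.
  rewrite -eigenvalue_root_char; apply/eigenvalueP; exists (row i P).
    by rewrite -row_mul PB row_mul row_diag_mx -scalemxAl -rowE kE.
  apply/eqP; rewrite rowE => /(congr1 (mulmx^~ (invmx P))).
  rewrite mulmxK // mul0mx => /matrixP/(_ 0 i); rewrite !mxE !eqxx.
  exact/eqP/oner_neq0.
apply: (map_mx_inj (f := f)); rewrite -/B map_scalar_mx BE dE.
by rewrite scalar_mxC mulmxKV.
Qed.

Section Trace.
Variables (R : realType) (V : vectType R).
Implicit Types f k : 'End(V).

Lemma lftrace_scalar : scalar (@lftrace R V).
Proof. by move=> a f k; rewrite /lftrace !linearP. Qed.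

HB.instance Definition _ :=
  GRing.isSemilinear.Build R _ R _ (@lftrace R V)
    (GRing.semilinear_linear lftrace_scalar).

Lemma lftrace_id : lftrace (\1%VF : 'End(V)) = (\dim {:V})%:R :> R.
Proof. by rewrite /lftrace mxof1 ?mxtrace1 // (basis_free (vbasisP _)). Qed.

Lemma lftrace_comp f k : lftrace (f \o k)%VF = lftrace (k \o f)%VF.
Proof.
have bB := vbasisP {:V}.
by rewrite /lftrace !(mxof_comp _ _ bB) mxtrace_mulC.
Qed.

End Trace.

(** The form [h] is a parameter so that the same results serve [g], [dot1 g] and [dot2 g]; at
    [dot2 g] this unfolds to the body of [orthonormal_basis2]. *)
Definition orthonormal_basis (R : realType) (V : vectType R) (h : V -> V -> R)
    (n : nat) (e : n.-tuple V) : Prop :=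
  basis_of {:V} e /\
  forall i j : 'I_n, h (tnth e i) (tnth e j) = (i == j)%:R.

Section Orthonormal.
Variables (R : realType) (V : vectType R) (h : {dot V for idfun}).

Lemma dotC (u v : V) : h u v = h v u.
Proof. by rewrite (hermC h) expr0 mul1r. Qed.

Lemma dotDl (u v w : V) : h (u + v) w = h u w + h v w.
Proof. exact: linearDl. Qed.

Lemma dotBl (u v w : V) : h (u - v) w = h u w - h v w.
Proof. exact: linearBl. Qed.

Lemma dotZl (a : R) (u v : V) : h (a *: u) v = a * h u v.
Proof. exact: linearZl_LR. Qed.

Lemma dotZr (a : R) (u v : V) : h u (a *: v) = a * h u v.
Proof. by rewrite dotC dotZl dotC. Qed.

Lemma dot_suml (I : finType) (F : I -> V) (v : V) :
  h (\sum_i F i) v = \sum_i h (F i) v.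
Proof. exact: linear_sumlz. Qed.

Lemma orthonormal_free (n : nat) (e : n.-tuple V) :
  (forall i j : 'I_n, h (tnth e i) (tnth e j) = (i == j)%:R) -> free e.
Proof.
move=> eO; apply/freeP => a /(congr1 (fun v => h v _)) a0 i.
have := a0 (tnth e i); rewrite dot_suml linear0l (bigD1 i) //= big1.
  by rewrite -tnth_nth dotZl eO eqxx mulr1 addr0.
by move=> j /negPf ji; rewrite -tnth_nth dotZl eO ji mulr0.
Qed.

Lemma orthonormal_basis_of (n : nat) (e : n.-tuple V) :
  n = \dim {:V} ->
  (forall i j : 'I_n, h (tnth e i) (tnth e j) = (i == j)%:R) ->
  orthonormal_basis h e.
Proof.
move=> nE eO; split=> //.
by rewrite basisEfree orthonormal_free //= size_tuple subvf nE /=.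
Qed.

Section Basis.
Variables (n : nat) (e : n.-tuple V).
Hypothesis eP : orthonormal_basis h e.

Lemma orthonormal_coord (i : 'I_n) (v : V) : coord e i v = h v (tnth e i).
Proof.
have [eB eO] := eP; rewrite [in RHS](coord_basis eB (memvf v)) dot_suml.
rewrite (bigD1 i) //= big1 => [|j /negPf ji].
  by rewrite -tnth_nth dotZl eO eqxx mulr1 addr0.
by rewrite -tnth_nth dotZl eO ji mulr0.
Qed.

Lemma orthonormal_sum (v : V) : v = \sum_(i < n) h v (tnth e i) *: tnth e i.
Proof.
rewrite {1}(coord_basis eP.1 (memvf v)); apply: eq_bigr => i _.
by rewrite orthonormal_coord (tnth_nth 0).
Qed.

Lemma parseval (u v : V) :
  h u v = \sum_(i < n) h u (tnth e i) * h v (tnth e i).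
Proof.
rewrite {1}(orthonormal_sum u) dot_suml; apply: eq_bigr => i _.
by rewrite dotZl [h v _]dotC.
Qed.

Lemma lftrace_orthonormal (f : 'End(V)) :
  lftrace f = \sum_(i < n) h (f (tnth e i)) (tnth e i).
Proof.
(* [lftrace_basis] expects a tuple of length [\dim {:V}], so [n] is replaced by this dimension with
   [e] generalized. *)
have nE := size_basis eP.1; move: e eP orthonormal_coord.
rewrite -{}nE => e' e'P coordE; rewrite -(lftrace_basis f e'P.1).
apply: eq_bigr => i _; rewrite !mxE /= vecof_delta.
by rewrite coordE -tnth_nth.
Qed.

End Basis.

(** Gram-Schmidt: an orthonormal family with fewer than [\dim {:V}] members is extended by the
    normalized component [w] of a vector outside its span. *)
Lemma orthonormal_basis_exists :
  exists e : (\dim {:V}).-tuple V, orthonormal_basis h e.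
Proof.
suff: forall k, (k <= \dim {:V})%N -> exists e : k.-tuple V,
    forall i j : 'I_k, h (tnth e i) (tnth e j) = (i == j)%:R.
  move=> /(_ _ (leqnn _)) [e eO]; exists e; exact: orthonormal_basis_of.
elim=> [|k IHk] kd; first by exists [tuple] => -[].
have [e eO] := IHk (ltnW kd).
have : ~~ ({:V} <= <<e>>)%VS.
  apply: contraTN kd => /dimvS de; rewrite -leqNgt.
  by apply: leq_trans de _; rewrite -{2}(size_tuple e) dim_span.
move=> /subvPn [v _ ve].
pose w := v - \sum_(i < k) h v (tnth e i) *: tnth e i.
have w0 : w != 0.
  apply: contraNneq ve => /eqP; rewrite subr_eq0 => /eqP ->.
  by apply: memv_suml => i _; rewrite memvZ // memv_span // mem_tnth.
have we i : h w (tnth e i) = 0.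
  rewrite dotBl dot_suml (bigD1 i) //= big1 => [|j /negPf ji].
    by rewrite dotZl eO eqxx mulr1 addr0 subrr.
  by rewrite dotZl eO ji mulr0.
pose c := (Num.sqrt (h w w))^-1.
have wwp : 0 < h w w by exact: neq0_dnorm_gt0.
have cw : c * (c * h w w) = 1.
  by rewrite mulrA -expr2 exprVn sqr_sqrtr ?ltW // mulVf ?gt_eqF.
exists [tuple of c *: w :: e] => i j.
case: (unliftP ord0 i) => [i'|] ->; case: (unliftP ord0 j) => [j'|] ->;
  rewrite ?(tnthS, tnth0).
- by rewrite eO (inj_eq lift_inj).
- by rewrite dotC dotZl we mulr0.
- by rewrite dotZl we mulr0.
- by rewrite dotZl dotZr cw.
Qed.

Lemma dot_ge0 (v : V) : 0 <= h v v.
Proof.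
by have [->|/(neq0_dnorm_gt0 (s := h))/ltW //] := eqVneq v 0; rewrite linear0l.
Qed.

Definition self_adjoint (f : 'End(V)) := forall u v, h (f u) v = h u (f v).

(** In an orthonormal basis the matrix of [f] is symmetric. Since [mxof] acts on row vectors, its
    left eigenvectors are the coordinates of eigenvectors of [f]. *)
Lemma self_adjoint_scalar (f : 'End(V)) (l : R) :
  self_adjoint f -> (forall a v, v != 0 -> f v = a *: v -> a = l) ->
  f = l *: \1%VF.
Proof.
move=> fsa fl; have [e eP] := orthonormal_basis_exists.
have eB := eP.1.
have ME : mxof e e f = l%:M.
  apply: symmetric_scalar_mx.
    apply/matrixP => i j; rewrite !mxE /= !vecof_delta.
    by rewrite !(orthonormal_coord eP) -!tnth_nth fsa dotC.
  move=> a /eigenvalueP [v vE v0]; apply: (fl a (vecof e v)).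
    by rewrite vecof_eq0.
  by rewrite (hom_vecof _ eB) vE linearZ.
apply: (can_inj (mxofK eB eB)).
by rewrite ME linearZ /= mxof1 ?scalemx1 // (basis_free eB).
Qed.

(** In an orthonormal basis the trace of the square is the sum of the squared norms of the
    [f e_i]. *)
Lemma self_adjoint_trace_sqr_eq0 (f : 'End(V)) :
  self_adjoint f -> lftrace (f \o f)%VF = 0 -> f = 0.
Proof.
move=> fsa; have [e eP] := orthonormal_basis_exists.
rewrite (lftrace_orthonormal eP).
under eq_bigr => i _ do rewrite comp_lfunE fsa.
move/eqP; rewrite psumr_eq0 => [/allP f0|i _]; last exact: dot_ge0.
apply/lfunP => v; rewrite {1}(orthonormal_sum eP v) linear_sum /= lfunE /=.
rewrite big1 // => i _; rewrite linearZ /=.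
have /eqP/dot_eq0 -> := f0 i (mem_index_enum i); exact: scaler0.
Qed.

End Orthonormal.

(** * Curvature of a 2-step nilpotent metric Lie algebra *)

Section Factors.
Variables (R : realType) (V1 V2 : vectType R).
Variable g : {dot (V1 * V2)%type for idfun}.

(** * Inner products and traces on the two factors *)

HB.instance Definition _ :=
  bilinear_isBilinear.Build R V1 V1 R *%R (idfun \; *%R) (dot1 g)
    (dot1_bilinear g).

Lemma dot1_symmetric (X Y : V1) :
  dot1 g X Y = (-1) ^+ false * idfun (dot1 g Y X).
Proof. exact: hermC. Qed.

HB.instance Definition _ :=
  isHermitianSesquilinear.Build R V1 false idfun (dot1 g) dot1_symmetric.

Lemma dot1_gt0 (X : V1) : X != 0 -> 0 < dot1 g X X.
Proof.
by move=> X0; apply: neq0_dnorm_gt0; apply: contraNneq X0 => -[->].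
Qed.

HB.instance Definition _ := isDotProduct.Build R V1 (dot1 g) dot1_gt0.

Lemma dot2_bilinear : bilinear_for *%R *%R (dot2 g).
Proof.
have E a (u v : V2) : (0, a *: u + v) = a *: (0, u) + (0, v) :> V1 * V2.
  by congr pair; rewrite /= scaler0 addr0.
split=> w a u v; rewrite /dot2 E; [exact: (dot_bilinear g).1|].
exact: (dot_bilinear g).2.
Qed.

HB.instance Definition _ :=
  bilinear_isBilinear.Build R V2 V2 R *%R (idfun \; *%R) (dot2 g)
    dot2_bilinear.

Lemma dot2_symmetric (X Y : V2) :
  dot2 g X Y = (-1) ^+ false * idfun (dot2 g Y X).
Proof. exact: hermC. Qed.

HB.instance Definition _ :=
  isHermitianSesquilinear.Build R V2 false idfun (dot2 g) dot2_symmetric.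

Lemma dot2_gt0 (Z : V2) : Z != 0 -> 0 < dot2 g Z Z.
Proof.
by move=> Z0; apply: neq0_dnorm_gt0; apply: contraNneq Z0 => -[->].
Qed.

HB.instance Definition _ := isDotProduct.Build R V2 (dot2 g) dot2_gt0.

Hypothesis g_orth : forall (X : V1) (Z : V2), g (X, 0) (0, Z) = 0.

Lemma dot_pair (x y : V1 * V2) : g x y = dot1 g x.1 y.1 + dot2 g x.2 y.2.
Proof.
have E (z : V1 * V2) : z = (z.1, 0) + (0, z.2).
  by case: z => a b; congr pair; rewrite /= ?addr0 ?add0r.
rewrite [in LHS](E x) [in LHS](E y) linearDl /= !linearD /= g_orth.
rewrite [g (0, _) (_, 0)]dotC g_orth.
by rewrite addr0 add0r.
Qed.

(** The concatenation [t] of the two bases is orthonormal for [g], by orthogonality of the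
    factors. *)
Lemma lftrace_pair (p q : nat) (e : p.-tuple V1) (z : q.-tuple V2)
    (f : 'End((V1 * V2)%type)) :
  orthonormal_basis (dot1 g) e -> orthonormal_basis (dot2 g) z ->
  lftrace f = \sum_(i < p) dot1 g (f (tnth e i, 0)).1 (tnth e i)
            + \sum_(j < q) dot2 g (f (0, tnth z j)).2 (tnth z j).
Proof.
move=> eP zP.
pose t := [tuple of map_tuple (fun X : V1 => (X, 0 : V2)) e
                 ++ map_tuple (fun Z : V2 => (0 : V1, Z)) z].
have tl i : tnth t (lshift q i) = (tnth e i, 0) by rewrite tnth_lshift tnth_map.
have tr j : tnth t (rshift p j) = (0, tnth z j) by rewrite tnth_rshift tnth_map.
have tP : orthonormal_basis g t.
  apply: orthonormal_basis_of => [|i j].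
    by rewrite dimvf /dim /= -!dimvf (size_basis eP.1) (size_basis zP.1).
  rewrite -(splitK i) -(splitK j).
  case: (split i) => a; case: (split j) => b; rewrite /= ?tl ?tr dot_pair /=.
  - by rewrite linear0r addr0 eP.2 (inj_eq (@lshift_inj _ _)).
  - by rewrite linear0r linear0l addr0 eq_lrshift.
  - by rewrite linear0r linear0l addr0 eq_rlshift.
  - by rewrite linear0r add0r zP.2 (inj_eq (@rshift_inj _ _)).
rewrite (lftrace_orthonormal tP) big_split_ord /=.
congr (_ + _); apply: eq_bigr => i _; rewrite ?tl ?tr dot_pair /=.
  by rewrite [dot2 g _ 0]linear0r addr0.
by rewrite [dot1 g _ 0]linear0r add0r.
Qed.

Variable mu : {bilinear V1 -> V1 -> V2}.
Hypothesis mu_skew : forall X Y : V1, mu X Y = - mu Y X.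

Local Notation J := (Jmap g mu).
Local Notation nabla := (lc_conn g (bracket mu)).
Local Notation Rm := (riem_curv g (bracket mu)).

Lemma dot_Jmap (Z : V2) (X Y : V1) : dot1 g (J Z X) Y = dot2 g (mu X Y) Z.
Proof. exact: Jmap_spec. Qed.

Lemma Jmap_skew (Z : V2) (X Y : V1) : dot1 g (J Z X) Y = - dot1 g X (J Z Y).
Proof. by rewrite [dot1 g X _]dotC /= !dot_Jmap mu_skew linearNl. Qed.

Lemma JmapZ (a : R) (Z : V2) : J (a *: Z) = a *: J Z.
Proof.
apply/lfunP => X; apply: (dot_ext (g := dot1 g)) => Y.
by rewrite lfunE /= dotZl /= !dot_Jmap dotZr.
Qed.

(** * Levi-Civita connection on the two factors *)

Lemma nabla11 (X Y : V1) : nabla (X, 0) (Y, 0) = (0, 2^-1 *: mu X Y).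
Proof.
apply: (dot_ext (g := g)) => z; rewrite lc_connP !dot_pair /=.
rewrite !(linear0l, linear0r) !dotZl /= !addr0 !add0r; lra.
Qed.

Lemma nabla12 (X : V1) (Z : V2) : nabla (X, 0) (0, Z) = (- 2^-1 *: J Z X, 0).
Proof.
apply: (dot_ext (g := g)) => z; rewrite lc_connP !dot_pair /=.
rewrite !(linear0l, linear0r) !dotZl /= dot_Jmap mu_skew linearNl /=; lra.
Qed.

Lemma nabla21 (X : V1) (Z : V2) : nabla (0, Z) (X, 0) = (- 2^-1 *: J Z X, 0).
Proof.
apply: (dot_ext (g := g)) => z; rewrite lc_connP !dot_pair /=.
rewrite !(linear0l, linear0r) !dotZl /= dot_Jmap /=; lra.
Qed.

Lemma nabla22 (Z W : V2) : nabla (0, Z) (0, W) = 0.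
Proof.
apply: (dot_ext (g := g)) => z; rewrite lc_connP !dot_pair /=.
rewrite !(linear0l, linear0r) /=; lra.
Qed.

Lemma bracket11 (X Y : V1) : bracket mu (X, 0) (Y, 0) = (0, mu X Y).
Proof. by []. Qed.

Lemma bracket2l (Z : V2) (x : V1 * V2) : bracket mu (0, Z) x = 0.
Proof. by rewrite /bracket /= linear0l. Qed.

Lemma bracket2r (Z : V2) (x : V1 * V2) : bracket mu x (0, Z) = 0.
Proof. by rewrite /bracket /= linear0r. Qed.

Lemma nabla0l (x : V1 * V2) : nabla 0 x = 0.
Proof.
have /= := lc_conn_linl g (bracket mu) x (-1) 0 0.
by rewrite scaler0 addr0 scaleN1r addNr.
Qed.

Lemma nabla0r (x : V1 * V2) : nabla x 0 = 0.
Proof.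
have /= := lc_conn_linr g (bracket mu) x (-1) 0 0.
by rewrite scaler0 addr0 scaleN1r addNr.
Qed.

Lemma mu_diag (X : V1) : mu X X = 0.
Proof.
apply/eqP; have /eqP := mu_skew X X.
by rewrite -addr_eq0 -mulr2n -scaler_nat scaler_eq0 pnatr_eq0.
Qed.

(** * Curvature components and the Ricci tensor *)

Lemma riem_curv111 (X Y Y' : V1) :
  dot1 g (Rm (X, 0) (Y, 0) (Y', 0)).1 X = - (3 / 4) * dot2 g (mu X Y) (mu X Y').
Proof.
(* After pairing with [X], the first term of the curvature vanishes by [mu X X = 0]; the second
   contributes -1/4 and the bracket term -1/2. *)
rewrite /riem_curv bracket11 !nabla11 !nabla12 nabla21 /=.
rewrite !dotBl !JmapZ !lfunE /= !dotZl /= !dot_Jmap mu_diag.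
rewrite (mu_skew Y X) (mu_skew Y' X) !linearNl /=.
rewrite linear0l [dot2 g (mu X Y') _]dotC /=; lra.
Qed.

Lemma riem_curv211 (Z : V2) (Y Y' : V1) :
  dot2 g (Rm (0, Z) (Y, 0) (Y', 0)).2 Z = 4^-1 * dot1 g (J Z Y) (J Z Y').
Proof.
rewrite /riem_curv bracket2l nabla0l !nabla11 nabla22 nabla21 nabla11 /=.
rewrite !dotBl [mu Y _]linearZr_LR /= !dotZl /= dot_Jmap linear0l /=; lra.
Qed.

Lemma riem_curv122 (X : V1) (W W' : V2) :
  (Rm (X, 0) (0, W) (0, W')).1 = - 4^-1 *: J W (J W' X).
Proof.
rewrite /riem_curv bracket2r nabla0l nabla22 nabla0r nabla12 nabla21 /=.
rewrite subr0 sub0r [J W (_ *: _)]linearZ /= scalerA -scaleNr.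
by congr (_ *: _); lra.
Qed.

Lemma riem_curv222 (Z W W' : V2) : Rm (0, Z) (0, W) (0, W') = 0.
Proof.
by rewrite /riem_curv bracket2l nabla0l !nabla22 !subr0.
Qed.

Lemma ricci_tensor_pair (p q : nat) (e : p.-tuple V1) (z : q.-tuple V2)
    (x y : V1 * V2) :
  orthonormal_basis (dot1 g) e -> orthonormal_basis (dot2 g) z ->
  ricci_tensor g (bracket mu) x y =
    \sum_(i < p) dot1 g (Rm (tnth e i, 0) x y).1 (tnth e i)
  + \sum_(j < q) dot2 g (Rm (0, tnth z j) x y).2 (tnth z j).
Proof.
move=> eP zP; rewrite /ricci_tensor (lftrace_pair _ eP zP).
by congr (_ + _); apply: eq_bigr => i _; rewrite lfun_linE //;
  apply: riem_curv_lin1.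
Qed.

(** The n1 directions contribute -3/4 and the n2 directions 1/4 of the same sum. *)
Lemma ricci_tensor11 (q : nat) (z : q.-tuple V2) (Y Y' : V1) :
  orthonormal_basis (dot2 g) z ->
  ricci_tensor g (bracket mu) (Y, 0) (Y', 0) =
    - 2^-1 * \sum_(j < q) dot1 g (J (tnth z j) Y) (J (tnth z j) Y').
Proof.
move=> zP; have [e eP] := orthonormal_basis_exists (dot1 g).
rewrite (ricci_tensor_pair _ _ eP zP).
under eq_bigr do rewrite riem_curv111.
under [X in _ + X]eq_bigr do rewrite riem_curv211.
rewrite -!mulr_sumr.
(* By Parseval in each factor, both sides are the double sum of the products of
   [dot2 g (mu Y e_i) z_j] and [dot2 g (mu Y' e_i) z_j]. *)
suff -> : \sum_i dot2 g (mu (tnth e i) Y) (mu (tnth e i) Y')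
        = \sum_(j < q) dot1 g (J (tnth z j) Y) (J (tnth z j) Y') by lra.
under eq_bigr do rewrite (parseval zP).
under [RHS]eq_bigr do rewrite (parseval eP) /=.
rewrite exchange_big; apply: eq_bigr => j _; apply: eq_bigr => i _ /=.
by rewrite !dot_Jmap [mu Y _]mu_skew [mu Y' _]mu_skew !linearNl /= mulrNN.
Qed.

Lemma ricci_tensor22 (W W' : V2) :
  ricci_tensor g (bracket mu) (0, W) (0, W') =
    - 4^-1 * lftrace (J W \o J W')%VF.
Proof.
have [e eP] := orthonormal_basis_exists (dot1 g).
have [z zP] := orthonormal_basis_exists (dot2 g).
rewrite (ricci_tensor_pair _ _ eP zP) (lftrace_orthonormal eP) mulr_sumr.
rewrite [X in _ + X]big1 => [|j _]; last by rewrite riem_curv222 linear0l.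
rewrite addr0; apply: eq_bigr => i _.
by rewrite riem_curv122 dotZl comp_lfunE.
Qed.

(** * Nilsoliton derivations *)

Section NonsingularDerivation.
Variables (D1 : 'End(V1)) (D2 : 'End(V2)).
Hypothesis D_der : forall X Y, D2 (mu X Y) = mu (D1 X) Y + mu X (D1 Y).
Hypotheses (D1_sa : self_adjoint (dot1 g) D1)
  (D2_sa : self_adjoint (dot2 g) D2).

(** Pair the derivation identity with [Z] and move [D1] and [D2] across the inner products by
    self-adjointness. *)
Lemma Jmap_eigenvector (a : R) (Z : V2) :
  D2 Z = a *: Z -> a *: J Z = (J Z \o D1)%VF + (D1 \o J Z)%VF.
Proof.
move=> ZE; apply/lfunP => X; apply: (dot_ext (g := dot1 g)) => Y.
rewrite scale_lfunE add_lfunE !comp_lfunE dotDl /= [dot1 g (D1 _) _]D1_sa /=.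
rewrite !dot_Jmap -dotDl -D_der.
by rewrite D2_sa ZE dotZr dotZl /= dot_Jmap.
Qed.

(* At an eigenvector Z of D2 with eigenvalue a, J(Z)^-1 D1 J(Z) + D1 = a I. *)
Lemma nonsingular_derivation_scalar :
  (0 < \dim {:V1})%N -> nonsingular g mu ->
  D2 = (2 * lftrace D1 / (\dim {:V1})%:R) *: \1%VF.
Proof.
move=> m_gt0 Jns; apply: (self_adjoint_scalar D2_sa) => a Z Z0 ZE.
have kJ : lker (J Z) == 0%VS by apply/lker0P/bij_inj/Jns.
have m0 : (\dim {:V1})%:R != 0 :> R by rewrite pnatr_eq0 -lt0n.
(* Composing with the inverse of [J Z] and taking traces gives [a * m = 2 * lftrace D1], with [m]
   the dimension of [V1], since the trace is invariant under conjugation. *)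
have /(congr1 (fun f => lftrace ((J Z)^-1 \o f)%VF)) := Jmap_eigenvector ZE.
rewrite -comp_lfunZr comp_lfunDr comp_lfunA lker0_compVf // comp_lfun1l.
rewrite linearZ linearD /= lftrace_id lftrace_comp -comp_lfunA.
rewrite lker0_compfV // comp_lfun1r => aE.
by apply: (mulIf m0); rewrite divfK // aE; ring.
Qed.

End NonsingularDerivation.

(** By skewness each diagonal entry of the square is minus the squared norm of some [J Z e_i], which
    is nonzero because [J Z] is injective. *)
Lemma lftrace_Jmap_sqr_lt0 (Z : V2) :
  (0 < \dim {:V1})%N -> nonsingular g mu -> Z != 0 ->
  lftrace (J Z \o J Z)%VF < 0.
Proof.
move=> m_gt0 Jns Z0; have [e eP] := orthonormal_basis_exists (dot1 g).
rewrite (lftrace_orthonormal eP) -oppr_gt0 -sumrN.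
have pos i : 0 < - dot1 g ((J Z \o J Z)%VF (tnth e i)) (tnth e i).
  rewrite comp_lfunE Jmap_skew opprK dot1_gt0 //.
  rewrite -(linear0 (J Z)) (inj_eq (bij_inj (Jns _ Z0))).
  apply: contraNneq (oner_neq0 R) => e0; have := eP.2 i i.
  by rewrite e0 linear0l eqxx => /esym/eqP.
rewrite (bigD1 (Ordinal m_gt0)) //= ltr_pwDl // sumr_ge0 // => i _.
exact: ltW.
Qed.

(** Anticommutation and cyclicity make the trace of [S] composed with each square [f i \o f i] equal
    to its own opposite. Substituting [SE] for one factor of [S \o S] then gives trace 0. *)
Lemma anticommutator_self_adjoint_eq0 (I : finType) (f : I -> 'End(V1))
    (S : 'End(V1)) (k a : R) :
  self_adjoint (dot1 g) S -> lftrace S = 0 ->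
  (forall i, (f i \o S)%VF + (S \o f i)%VF = 0) ->
  S = k *: (\sum_i (f i \o f i)%VF) - a *: \1%VF -> S = 0.
Proof.
move=> Ssa trS0 fS SE; apply: (self_adjoint_trace_sqr_eq0 Ssa).
have tr0 i : lftrace (S \o (f i \o f i))%VF = 0.
  have /(congr1 (fun h => lftrace (f i \o h)%VF)) := fS i.
  rewrite comp_lfunDr comp_lfun0r linearD linear0 /= [X in _ + X]lftrace_comp.
  rewrite -!comp_lfunA comp_lfunA lftrace_comp => E; lra.
rewrite {2}SE comp_lfunDr linearD /= -scaleNr -!comp_lfunZr !linearZ /=.
rewrite comp_lfun1r trS0 mulr0 addr0.
have -> : (S \o (\sum_i (f i \o f i)%VF))%VF
        = \sum_i (S \o (f i \o f i))%VF.
  apply/lfunP => X; rewrite comp_lfunE !sum_lfunE linear_sum /=.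
  by apply: eq_bigr => i _; rewrite !comp_lfunE.
by rewrite linear_sum big1 ?mulr0 // => i _; apply: tr0.
Qed.

(** [D1] and [D2] are the diagonal blocks of [D]. The off-diagonal blocks drop out: the bracket sees
    only n1 components and lands in n2, and the factors are orthogonal. *)
Lemma nilsoliton_blocks :
  nilsoliton g (bracket mu) ->
  exists (c : R) (D1 : 'End(V1)) (D2 : 'End(V2)),
    [/\ forall X Y, D2 (mu X Y) = mu (D1 X) Y + mu X (D1 Y),
        forall X Y, dot1 g (D1 X) Y =
          ricci_tensor g (bracket mu) (X, 0) (Y, 0) - c * dot1 g X Y &
        forall Z W, dot2 g (D2 Z) W =
          ricci_tensor g (bracket mu) (0, Z) (0, W) - c * dot2 g Z W].
Proof.
move=> [c [D [Dder RicE]]].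
pose D1 := linfun (fun X : V1 => (D (X, 0)).1).
pose D2 := linfun (fun Z : V2 => (D (0, Z)).2).
have D1E X : D1 X = (D (X, 0)).1.
  apply: (@lfun_linE _ _ _ (fun X : V1 => (D (X, 0)).1)) => a u v.
  have -> : (a *: u + v, 0) = a *: (u, 0) + (v, 0) :> V1 * V2.
    by congr pair; rewrite /= scaler0 addr0.
  by rewrite linearP.
have D2E Z : D2 Z = (D (0, Z)).2.
  apply: (@lfun_linE _ _ _ (fun Z : V2 => (D (0, Z)).2)) => a u v.
  have -> : (0, a *: u + v) = a *: (0, u) + (0, v) :> V1 * V2.
    by congr pair; rewrite /= scaler0 addr0.
  by rewrite linearP.
exists c, D1, D2; split=> [X Y|X Y|Z W].
- by rewrite D2E !D1E -bracket11 Dder.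
- rewrite -ricci_opP RicE add_lfunE scale_lfunE id_lfunE dotDl dotZl D1E.
  by rewrite -/(dot1 g X Y) addrAC subrr add0r dot_pair /=
    [dot2 g _ 0]linear0r addr0.
- rewrite -ricci_opP RicE add_lfunE scale_lfunE id_lfunE dotDl dotZl D2E.
  by rewrite -/(dot2 g Z W) addrAC subrr add0r dot_pair /=
    [dot1 g _ 0]linear0r add0r.
Qed.

End Factors.

(** * The two trace identities and the signs of their constants *)

Theorem theorem1p1 (R : realType) (m n : nat) (m_ge1 : (1 <= m)%N)
    (n_ge1 : (1 <= n)%N) (V1 V2 : vectType R)
    (dimV1 : \dim {:V1} = m) (dimV2 : \dim {:V2} = n)
    (g : {dot (V1 * V2)%type for idfun})
    (g_orth : forall (X : V1) (Z : V2), g (X, 0) (0, Z) = 0)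
    (mu : {bilinear V1 -> V1 -> V2})
    (mu_skew : forall X Y : V1, mu X Y = - mu Y X)
    (mu_nonsingular : nonsingular g mu)
    (g_nilsoliton : nilsoliton g (bracket mu)) :
  exists a b : R,
    [/\ a < 0, b < 0 &
      forall Z : n.-tuple V2, orthonormal_basis2 g Z ->
        \sum_(i < n) (Jmap g mu (tnth Z i) \o Jmap g mu (tnth Z i))%VF
          = a *: \1%VF
        /\ forall i j : 'I_n,
             lftrace (Jmap g mu (tnth Z i) \o Jmap g mu (tnth Z j))%VF
               = b * (i == j)%:R].
Proof.
have [c [D1 [D2 [D_der D1E D2E]]]] := nilsoliton_blocks g_orth g_nilsoliton.
have D1_sa : self_adjoint (dot1 g) D1.
  move=> X Y; have [z zP] := orthonormal_basis_exists (dot2 g).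
  rewrite [RHS]dotC /= !D1E !(ricci_tensor11 g_orth mu_skew _ _ zP).
  rewrite [dot1 g Y X]dotC /=; congr (_ * _ - _).
  by apply: eq_bigr => j _; rewrite dotC.
have D2_sa : self_adjoint (dot2 g) D2.
  move=> Z W; rewrite [RHS]dotC /= !D2E !(ricci_tensor22 g_orth mu_skew).
  by rewrite lftrace_comp [dot2 g W Z]dotC.
have m_gt0 : (0 < \dim {:V1})%N by rewrite dimV1.
have m0 : (\dim {:V1})%:R != 0 :> R by rewrite pnatr_eq0 -lt0n.
pose l := 2 * lftrace D1 / (\dim {:V1})%:R.
have D2l : D2 = l *: \1%VF.
  exact: (nonsingular_derivation_scalar D_der).
(* With [D2 = l I], the n2 block of the soliton equation reads [- 1/4 tr(J W J W') - c <W, W'> = l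
   <W, W'>]; this fixes [b = - 4 * (c + l)]. *)
have trJ (W W' : V2) :
    lftrace (Jmap g mu W \o Jmap g mu W')%VF = - 4 * (c + l) * dot2 g W W'.
  have := D2E W W'.
  rewrite D2l lfunE /= lfunE /= dotZl (ricci_tensor22 g_orth mu_skew) /= => E.
  lra.
(* The length [k] is free because this is applied both to an [n]-tuple and to a basis of length
   [\dim {:V2}]. The constant comes from [D1 = Q / 2 - c I] once [D1 = (l / 2) I] is known. *)
have sumJ k (z : k.-tuple V2) : orthonormal_basis (dot2 g) z ->
    \sum_(i < k) (Jmap g mu (tnth z i) \o Jmap g mu (tnth z i))%VF
      = (2 * c + l) *: \1%VF.
  move=> zP.
  pose Q := \sum_(i < k) (Jmap g mu (tnth z i) \o Jmap g mu (tnth z i))%VF.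
  have D1Q : D1 = 2^-1 *: Q - c *: \1%VF.
    apply/lfunP => X; apply: (dot_ext (g := dot1 g)) => Y.
    rewrite /= D1E (ricci_tensor11 g_orth mu_skew _ _ zP).
    rewrite add_lfunE opp_lfunE !scale_lfunE id_lfunE [RHS]dotBl !dotZl /=.
    rewrite sum_lfunE dot_suml mulNr -mulrN -sumrN; congr (_ * _ - _).
    by apply: eq_bigr => i _; rewrite comp_lfunE [RHS](Jmap_skew _ mu_skew).
  pose S := D1 - (l / 2) *: \1%VF.
  suff S0 : S = 0.
    have QE : Q = 2 *: (S + (c + l / 2) *: \1%VF).
      rewrite /S D1Q (scalerDl _ c) -[_ - _ - _]addrA -opprD subrK.
      by rewrite scalerA divff ?scale1r ?pnatr_eq0.
    rewrite -/Q QE S0 add0r scalerA; congr (_ *: _); lra.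
  apply: (anticommutator_self_adjoint_eq0 (g := g)
    (f := fun i => Jmap g mu (tnth z i)) (k := 2^-1) (a := c + l / 2)).
  - move=> X Y; rewrite /S add_lfunE opp_lfunE scale_lfunE id_lfunE dotBl dotZl.
    rewrite [RHS]dotC add_lfunE opp_lfunE scale_lfunE id_lfunE dotBl dotZl.
    by congr (_ - _ * _); [rewrite D1_sa|]; apply: (dotC (dot1 g)).
  (* [S] is traceless by the choice of [l] as twice the trace of [D1] over the dimension. *)
  - rewrite /S linearB linearZ /= lftrace_id /l; field.
    by rewrite m0.
  (* Every vector is an eigenvector of [D2] for [l], so [l J = J D1 + D1 J]; each of the two
     products with [S] removes half of [l J]. *)
  - move=> i; apply/lfunP => X; rewrite add_lfunE !comp_lfunE zero_lfunE.
    have zE : D2 (tnth z i) = l *: tnth z i by rewrite D2l scale_lfunE id_lfunE.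
    have /lfunP/(_ X) := Jmap_eigenvector D_der D1_sa D2_sa zE.
    rewrite scale_lfunE add_lfunE !comp_lfunE => E.
    rewrite /S !add_lfunE !opp_lfunE !scale_lfunE !id_lfunE linearB linearZ /=.
    by rewrite addrACA -E -opprD -scalerDl -splitr subrr.
  - by rewrite /S D1Q -/Q -addrA -opprD -scalerDl.
have b_lt0 W : W != 0 -> - 4 * (c + l) * dot2 g W W < 0.
  by move=> W0; rewrite -trJ lftrace_Jmap_sqr_lt0.
have [z zP] := orthonormal_basis_exists (dot2 g).
have n_gt0 : (0 < \dim {:V2})%N by rewrite dimV2.
pose i0 := Ordinal n_gt0.
have z_neq0 i : tnth z i != 0.
  apply: contraNneq (oner_neq0 R) => z0; have := zP.2 i i.
  by rewrite z0 linear0l eqxx => /esym/eqP.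
exists (2 * c + l), (- 4 * (c + l)); split.
(* The trace of the first identity equates [(2 * c + l)] times the dimension of [V1] with a nonempty
   sum of negative traces. *)
- have := congr1 (@lftrace R V1) (sumJ _ _ zP).
  rewrite linear_sum linearZ /= lftrace_id => E.
  have m_pos : 0 < (\dim {:V1})%:R :> R by rewrite ltr0n.
  rewrite -(pmulr_llt0 _ m_pos) -E -oppr_gt0 -sumrN (bigD1 i0) //=.
  rewrite ltr_pwDl ?sumr_ge0 ?oppr_gt0 ?lftrace_Jmap_sqr_lt0 // => i _.
  by rewrite oppr_ge0 ltW // lftrace_Jmap_sqr_lt0.
- by have := b_lt0 _ (z_neq0 i0); rewrite zP.2 eqxx mulr1.
move=> Z ZP; split; first exact: sumJ.
by move=> i j; rewrite trJ ZP.2.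
Qed.
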